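(* Let $p$ be a prime, $R=\mathbb{Z}_p[u,v]$, and let $\mathcal{C}$ be a $\mathbb{Z}_p\mathbb{Z}_p[u,v]$-additive cyclic code of length $(\alpha,\beta)$ given by $$\mathcal{C}=\langle (f_1,0),(f_2,g+up_1+vp_2)\rangle,$$ where $f_1,f_2,g,p_1,p_2\in\mathbb{Z}_p[x]$, $(g+up_1+vp_2)\mid(x^\beta-1)$ in $R[x]$, $f_1\mid(x^\alpha-1)$, and $\ker(\Pi|_{\mathcal{C}})=\langle(f_1,0)\rangle$. Let $\deg f_1=t_1$, $\deg g=t_2$ and $$S_1=\bigcup_{i=0}^{\alpha-t_1-1}\{x^i*(f_1,0)\},\qquad S_2=\bigcup_{i=0}^{\beta-t_2-1}\{x^i*(f_2,g+up_1+vp_2)\}.$$ Then $S=S_1\cup S_2$ is a minimal generating set of $\mathcal{C}$. Moreover, $|\mathcal{C}|=p^{\alpha-t_1+3(\beta-t_2)}$.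
   Context: $R=\mathbb{Z}_p[u,v]$ denotes the ring $\mathbb{Z}_p+u\mathbb{Z}_p+v\mathbb{Z}_p$ with $u^2=v^2=uv=vu=0$. $\rho:R\to\mathbb{Z}_p$, $\rho(a+ub+vc)=a$, extended coefficientwise to $R[x]\to\mathbb{Z}_p[x]$. $R_{\alpha,\beta}=\mathbb{Z}_p[x]/\langle x^\alpha-1\rangle\times R[x]/\langle x^\beta-1\rangle$ is an $R[x]$-module via $\gamma(x)*(c(x),d(x))=(\rho(\gamma(x))c(x),\gamma(x)d(x))$. $\Pi:R_{\alpha,\beta}\to R[x]/\langle x^\beta-1\rangle$ is the projection $\Pi(c,d)=d$. A $\mathbb{Z}_p\mathbb{Z}_p[u,v]$-additive cyclic code of length $(\alpha,\beta)$ is an $R[x]$-submodule of $R_{\alpha,\beta}$ (words in $\mathbb{Z}_p^\alpha\times R^\beta$ being identified with pairs of polynomials). $\langle\cdot\rangle$ is the $R[x]$-submodule generated. A minimal generating set is a set generating $\mathcal{C}$ as an $R$-module in which no element is an $R$-linear combination of the remaining ones. *)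

(* Defs.v *)
From HB Require Import structures.
From mathcomp Require Import all_boot all_order all_algebra.
From mathcomp Require Import qpoly.

Set Implicit Arguments.
Unset Strict Implicit.
Unset Printing Implicit Defensive.

Import GRing.Theory.
Local Open Scope ring_scope.

(* Z_p[u,v] = Z_p + u Z_p + v Z_p with u^2 = v^2 = uv = vu = 0;
   the triple (a, b, c) encodes a + ub + vc.  For p prime, Z_p is 'F_p. *)
Definition Zpuv (p : nat) : predArgType := ('F_p * 'F_p * 'F_p)%type.

Section ZpuvRing.
Context {p : nat}.
Implicit Types x y z : Zpuv p.

HB.instance Definition _ := Finite.on (Zpuv p).
HB.instance Definition _ := GRing.Zmodule.on (Zpuv p).

Definition Zpuv_mk (a b c : 'F_p) : Zpuv p := (a, b, c).
Definition Zpuv_one : Zpuv p := Zpuv_mk 1 0 0.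
Definition Zpuv_mul x y : Zpuv p :=
  Zpuv_mk (x.1.1 * y.1.1)
          (x.1.1 * y.1.2 + x.1.2 * y.1.1)
          (x.1.1 * y.2 + x.2 * y.1.1).

Fact Zpuv_mulA : associative Zpuv_mul.
Proof.
move=> [[a b] c] [[a' b'] c'] [[a2 b2] c2]; rewrite /Zpuv_mul /Zpuv_mk /=.
by congr (_, _, _); rewrite ?mulrDl ?mulrDr ?mulrA ?addrA.
Qed.

Fact Zpuv_mulC : commutative Zpuv_mul.
Proof.
move=> [[a b] c] [[a' b'] c']; rewrite /Zpuv_mul /Zpuv_mk /=.
by congr (_, _, _); rewrite 1?addrC ?[a' * _]mulrC ?[a * _]mulrC.
Qed.

Fact Zpuv_mul1 : left_id Zpuv_one Zpuv_mul.
Proof.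
by move=> [[a b] c]; rewrite /Zpuv_mul /Zpuv_mk /= !mul1r !mul0r !addr0.
Qed.

Fact Zpuv_mulDl : left_distributive Zpuv_mul +%R.
Proof.
move=> [[a b] c] [[a' b'] c'] [[a2 b2] c2]; rewrite /Zpuv_mul /Zpuv_mk /=.
by congr (_, _, _); rewrite ?mulrDl ?mulrDr // addrACA.
Qed.

Fact Zpuv_one_neq0 : Zpuv_one != 0.
Proof. by apply/eqP => -[] /eqP; rewrite oner_eq0. Qed.

HB.instance Definition _ := GRing.Zmodule_isComNzRing.Build (Zpuv p)
  Zpuv_mulA Zpuv_mulC Zpuv_mul1 Zpuv_mulDl Zpuv_one_neq0.

Definition Zpuv_u : Zpuv p := Zpuv_mk 0 1 0.
Definition Zpuv_v : Zpuv p := Zpuv_mk 0 0 1.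

Definition Zpuv_incl (a : 'F_p) : Zpuv p := Zpuv_mk a 0 0.
Definition rho x : 'F_p := x.1.1.

Fact rho_is_zmod_morphism : zmod_morphism rho. Proof. by []. Qed.
Fact rho_is_monoid_morphism : monoid_morphism rho. Proof. by []. Qed.
HB.instance Definition _ :=
  GRing.isZmodMorphism.Build (Zpuv p) 'F_p rho rho_is_zmod_morphism.
HB.instance Definition _ :=
  GRing.isMonoidMorphism.Build (Zpuv p) 'F_p rho rho_is_monoid_morphism.

Definition rhoX : {poly Zpuv p} -> {poly 'F_p} := map_poly rho.
HB.instance Definition _ := GRing.RMorphism.on rhoX.

(* g + u p1 + v p2 as an element of R[x] *)
Definition polyuv (g p1 p2 : {poly 'F_p}) : {poly Zpuv p} :=
  map_poly Zpuv_incl g + Zpuv_u *: map_poly Zpuv_incl p1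
    + Zpuv_v *: map_poly Zpuv_incl p2.

End ZpuvRing.

(* Z_p[x]/<x^alpha - 1> x R[x]/<x^beta - 1>.  {poly %/ 'X^n - 1} is the
   intended quotient ring only for n > 0 (for n = 0 it is a quotient by 'X). *)
Definition Rab (p alpha beta : nat) : predArgType :=
  ({poly %/ ('X^alpha - 1 : {poly 'F_p})}
   * {poly %/ ('X^beta - 1 : {poly Zpuv p})})%type.

Section RabModule.
Context {p alpha beta : nat}.
Let Rx : comNzRingType := {poly Zpuv p}.
Let V := Rab p alpha beta.

HB.instance Definition _ := Finite.on (Rab p alpha beta).
HB.instance Definition _ := GRing.Zmodule.on (Rab p alpha beta).

Definition Rab_mk (c : {poly 'F_p}) (d : {poly Zpuv p}) : V :=
  (in_qpoly ('X^alpha - 1) c, in_qpoly ('X^beta - 1) d).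

Definition Rab_scale (gamma : Rx) (w : V) : V :=
  (in_qpoly ('X^alpha - 1) (rhoX gamma) * w.1,
   in_qpoly ('X^beta - 1) gamma * w.2).

Fact Rab_scalerA a b w : Rab_scale a (Rab_scale b w) = Rab_scale (a * b) w.
Proof. by rewrite /Rab_scale /= !rmorphM !mulrA. Qed.

Fact Rab_scale1r : left_id 1 Rab_scale.
Proof. by case=> c d; rewrite /Rab_scale /= !rmorph1 !mul1r. Qed.

Fact Rab_scalerDr : right_distributive Rab_scale +%R.
Proof. by move=> a [c d] [c' d']; rewrite /Rab_scale /= !mulrDr. Qed.

Fact Rab_scalerDl w : {morph Rab_scale^~ w : a b / a + b}.
Proof. by move=> a b; rewrite /Rab_scale /= !rmorphD !mulrDl. Qed.

HB.instance Definition _ := GRing.Zmodule_isLmodule.Build Rx (Rab p alpha beta)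
  Rab_scalerA Rab_scale1r Rab_scalerDr Rab_scalerDl.

Definition Pi (w : V) : {poly %/ ('X^beta - 1 : {poly Zpuv p})} := w.2.

Definition additive_cyclic_code (C : {set V}) : Prop := submod_closed C.

Definition ker_Pi (C : {set V}) : {set V} := [set w in C | Pi w == 0].

(* C is the R[x]-submodule generated by S *)
Definition generated_by (S C : {set V}) : Prop :=
  forall w : V,
    w \in C <-> exists a : V -> {poly Zpuv p}, w = \sum_(s in S) a s *: s.

(* R acts through the constant polynomials of R[x] *)
Definition R_combination (S : {set V}) (w : V) : Prop :=
  exists a : V -> Zpuv p, w = \sum_(s in S) (a s)%:P *: s.

Definition minimal_generating_set (S C : {set V}) : Prop :=
  (forall w : V, w \in C <-> R_combination S w)
  /\ (forall s : V, s \in S -> ~ R_combination (S :\ s) s).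

End RabModule.

(* Main.v *)
Require Import Defs.
From HB Require Import structures.
From mathcomp Require Import all_boot all_order all_algebra.
From mathcomp Require Import qpoly.
From mathcomp Require Import ring.

Set Implicit Arguments.
Unset Strict Implicit.
Unset Printing Implicit Defensive.

Import GRing.Theory.
Local Open Scope ring_scope.

(* Write G = g + u p1 + v p2 and X^beta - 1 = h G. Since rho(h) is nonzero, one
   can divide by h in R[x] with a remainder of degree less than deg rho(h) =
   beta - t2. Modulo h, a multiple of (f2, G) therefore becomes an R-combination
   of S2, while h (f2, G) lies in ker Pi = <(f1, 0)>, whose elements reduce to
   combinations of S1 by dividing by (X^alpha - 1) / f1. Conversely, as G is not
   a zero divisor, a relation a (f1, 0) + b (f2, G) = 0 within the degree bounds
   forces h | b, so b = 0, and then rho(a) = 0. Thus every codeword is uniquely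
   a (f1, 0) + b (f2, G) with a over F_p, which also gives the cardinality. *)

(** * Divisibility by X^n - 1 and degrees of cofactors *)

Lemma in_qpoly_XnsubC1_eq0P (A : comNzRingType) n (c : {poly A}) :
  (0 < n)%N ->
  reflect (exists q, c = q * ('X^n - 1)) (in_qpoly ('X^n - 1 : {poly A}) c == 0).
Proof.
move=> n0.
have mX : ('X^n - 1 : {poly A}) \is monic by exact: monicXnsubC.
(* [mk_monic] falls back to ['X] on polynomials of size at most 1, so [0 < n] is what makes the
   quotient the intended one. *)
have eX : mk_monic ('X^n - 1 : {poly A}) = 'X^n - 1.
  by rewrite /mk_monic mX (@size_XnsubC _ _ 1) // ltnS n0.
apply: (iffP eqP) => [/(congr1 val)/=|[q ->]].
  by rewrite eX => /Pdiv.Ring.rmodp_eq0P/(Pdiv.RingMonic.rdvdpP mX).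
by apply/val_inj; rewrite /= eX Pdiv.RingMonic.rmodp_mull.
Qed.

Lemma size_mul_small_eq0 (F : fieldType) (q d : {poly F}) :
  (size (q * d)%R < size d)%N -> q = 0.
Proof.
move=> lt; apply: contraTeq lt => q0; rewrite -leqNgt.
have [-> |d0] := eqVneq d 0; first by rewrite size_poly0.
rewrite size_mul // -(prednK (n := size q)) ?lt0n ?size_poly_eq0 //.
by rewrite addSn leq_addl.
Qed.

Lemma size_cofactor_XnsubC1 (F : fieldType) n (k f : {poly F}) :
  (0 < n)%N -> 'X^n - 1 = k * f ->
  [/\ k != 0, f != 0 & size k = (n - (size f).-1).+1].
Proof.
move=> n0 e.
have s : size (k * f) = n.+1 by rewrite -e (@size_XnsubC _ _ 1).
have: k * f != 0 by rewrite -size_poly_gt0 s.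
rewrite mulf_eq0 negb_or => /andP[k0 f0]; split=> //.
move: s; rewrite size_mul // -(prednK (n := size f)) ?size_poly_gt0 //.
rewrite -(prednK (n := size k)) ?size_poly_gt0 // addnS addSn /= => -[<-].
by rewrite addnK.
Qed.

(** * Arithmetic of R[x] in components over F_p[x] *)

Section PolyUV.
Context {p : nat}.
Implicit Types (a b c : {poly 'F_p}).

Fact Zpuv_incl_is_zmod_morphism : zmod_morphism (@Zpuv_incl p).
Proof. by move=> x y; congr (_, _, _); rewrite subr0. Qed.
Fact Zpuv_incl_is_monoid_morphism : monoid_morphism (@Zpuv_incl p).
Proof.
by split=> // x y; congr (_, _, _) => /=; rewrite !(mulr0, mul0r) addr0.
Qed.
HB.instance Definition _ := GRing.isZmodMorphism.Build 'F_p (Zpuv p)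
  (@Zpuv_incl p) Zpuv_incl_is_zmod_morphism.
HB.instance Definition _ := GRing.isMonoidMorphism.Build 'F_p (Zpuv p)
  (@Zpuv_incl p) Zpuv_incl_is_monoid_morphism.

Lemma coef_polyuv a b c i : (polyuv a b c)`_i = Zpuv_mk a`_i b`_i c`_i.
Proof.
rewrite !coefD !coefZ !coef_map_id0 //.
by congr (_, _, _) => /=; rewrite !(mul0r, mulr0, mul1r, addr0, add0r).
Qed.

Lemma polyuv_surj (d : {poly Zpuv p}) : exists a b c, d = polyuv a b c.
Proof.
exists (\poly_(i < size d) (d`_i).1.1), (\poly_(i < size d) (d`_i).1.2),
  (\poly_(i < size d) (d`_i).2).
apply/polyP=> i; rewrite coef_polyuv !coef_poly.
case: ltnP => [_|/(nth_default 0) -> //].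
by case: (d`_i) => -[].
Qed.

Lemma polyuv_inj a b c a' b' c' :
  polyuv a b c = polyuv a' b' c' -> [/\ a = a', b = b' & c = c'].
Proof.
move=> /polyP e; split; apply/polyP=> i;
  by have := e i; rewrite !coef_polyuv => -[].
Qed.

Lemma polyuv0 : polyuv 0 0 0 = 0 :> {poly Zpuv p}.
Proof. by apply/polyP=> i; rewrite coef_polyuv !coef0. Qed.

Lemma polyuvD a b c a' b' c' :
  polyuv a b c + polyuv a' b' c' = polyuv (a + a') (b + b') (c + c').
Proof. by apply/polyP=> i; rewrite coefD !coef_polyuv !coefD. Qed.

Lemma polyuvM a b c a' b' c' :
  polyuv a b c * polyuv a' b' c' =
  polyuv (a * a') (a * b' + b * a') (a * c' + c * a').
Proof.
have nilp x y : x * y = 0 -> x%:P * y%:P = 0 :> {poly Zpuv p}.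
  by move=> xy; rewrite -rmorphM /= xy.
have zero : 0 = (0, 0, 0) :> Zpuv p by [].
have uu : Zpuv_u * Zpuv_u = 0 :> Zpuv p.
  by rewrite zero; congr (_, _, _) => /=; rewrite !(mul0r, mulr0, addr0).
have uv : Zpuv_u * Zpuv_v = 0 :> Zpuv p.
  by rewrite zero; congr (_, _, _) => /=; rewrite !(mul0r, mulr0, addr0).
have vv : Zpuv_v * Zpuv_v = 0 :> Zpuv p.
  by rewrite zero; congr (_, _, _) => /=; rewrite !(mul0r, mulr0, addr0).
rewrite /polyuv !rmorphD !rmorphM /= -!mul_polyC.
move: (nilp _ _ uu) (nilp _ _ uv) (nilp _ _ vv).
move: (Zpuv_u)%:P (Zpuv_v)%:P => u v {}uu {}uv {}vv.
set A := map_poly _ a; set B := map_poly _ b; set D := map_poly _ c.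
set A' := map_poly _ a'; set B' := map_poly _ b'; set D' := map_poly _ c'.
(* Here u and v are generic elements, so the expansion is a plain ring identity; the last three
   terms then vanish by the nilpotency relations. *)
transitivity (A * A' + u * (A * B' + B * A') + v * (A * D' + D * A')
  + u * u * (B * B') + u * v * (B * D' + D * B') + v * v * (D * D')).
  ring.
by rewrite uu uv vv !mul0r !addr0.
Qed.

Lemma rhoX_incl a : rhoX (map_poly (@Zpuv_incl p) a) = a.
Proof. by apply/polyP=> i; rewrite !coef_map. Qed.

Lemma rhoX_XnsubC1 n : rhoX ('X^n - 1 : {poly Zpuv p}) = 'X^n - 1.
Proof. by rewrite [LHS]rmorphB rmorph1 /= /rhoX map_polyXn. Qed.

Lemma rhoX_polyuv a b c : rhoX (polyuv a b c) = a.
Proof. by apply/polyP=> i; rewrite coef_map coef_polyuv. Qed.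

Lemma size_polyuv_leq a b c n :
  (size a <= n)%N -> (size b <= n)%N -> (size c <= n)%N ->
  (size (polyuv a b c) <= n)%N.
Proof.
move=> sa sb sc; apply/leq_sizeP=> i ni.
by rewrite coef_polyuv !nth_default //; apply: leq_trans ni.
Qed.

Lemma size_rhoX_leq (d : {poly Zpuv p}) : (size (rhoX d) <= size d)%N.
Proof. exact: size_poly. Qed.

(** In components the equation is triangular: q0 d0 = 0 gives q0 = 0, after which the u- and v-parts
    reduce to q1 d0 = 0 and q2 d0 = 0 in the domain F_p[x]. *)
Lemma polyZpuv_mul_eq0 (q d : {poly Zpuv p}) : rhoX d != 0 -> q * d = 0 -> q = 0.
Proof.
have [q0 [q1 [q2 ->]]] := polyuv_surj q.
have [d0 [d1 [d2 ->]]] := polyuv_surj d.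
rewrite rhoX_polyuv polyuvM => dn0; rewrite -[in X in _ = X -> _]polyuv0.
move=> /polyuv_inj[]/eqP; rewrite mulf_eq0 (negPf dn0) orbF => /eqP ->.
rewrite !mul0r !add0r => /eqP; rewrite mulf_eq0 (negPf dn0) orbF => /eqP ->.
by move=> /eqP; rewrite mulf_eq0 (negPf dn0) orbF => /eqP ->; rewrite polyuv0.
Qed.

(** The same triangular elimination, with a degree argument against d0 in place of the absence of
    zero divisors. *)
Lemma polyZpuv_mul_small_eq0 (q d : {poly Zpuv p}) :
  (size (q * d)%R < size (rhoX d))%N -> q = 0.
Proof.
have [q0 [q1 [q2 ->]]] := polyuv_surj q.
have [d0 [d1 [d2 ->]]] := polyuv_surj d.
rewrite rhoX_polyuv polyuvM => lt.
have lt_comp : forall a b c, (size (polyuv a b c) < size d0)%N ->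
    [/\ (size a < size d0)%N, (size b < size d0)%N & (size c < size d0)%N].
  move=> a b c abc; split; apply: leq_ltn_trans abc;
  by apply/leq_sizeP=> i /(nth_default 0); rewrite coef_polyuv => -[].
have [lt0 lt1 lt2] := lt_comp _ _ _ lt.
move/size_mul_small_eq0: lt0 lt1 lt2 => ->; rewrite !mul0r !add0r.
by move=> /size_mul_small_eq0-> /size_mul_small_eq0->; rewrite polyuv0.
Qed.

(* [d] need not have a unit leading coefficient: its u- and v-parts may have
   larger degree than [rhoX d], so the division goes component by component. *)
Lemma polyZpuv_edivp (b d : {poly Zpuv p}) : rhoX d != 0 ->
  exists q r, b = q * d + r /\ (size r < size (rhoX d))%N.
Proof.
have [b0 [b1 [b2 ->]]] := polyuv_surj b.
have [d0 [d1 [d2 ->]]] := polyuv_surj d.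
rewrite rhoX_polyuv => dn0.
pose q0 := b0 %/ d0; pose b1' := b1 - q0 * d1; pose b2' := b2 - q0 * d2.
exists (polyuv q0 (b1' %/ d0) (b2' %/ d0)).
exists (polyuv (b0 %% d0) (b1' %% d0) (b2' %% d0)); split; last first.
  have s0 : (0 < size d0)%N by rewrite lt0n size_poly_eq0.
  by rewrite -(prednK s0) ltnS size_polyuv_leq // -ltnS prednK // ltn_modp.
rewrite polyuvM polyuvD -!addrA -!divp_eq /b1' /b2'.
by rewrite ![q0 * _ + _]addrC !subrK.
Qed.
End PolyUV.

(** * Cardinality of R and sums of shifted generators *)

Lemma card_Zpuv p : prime p -> #|Zpuv p| = (p ^ 3)%N.
Proof.
by move=> pp; rewrite !card_prod !card_Fp // !expnS expn0 muln1 mulnA.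
Qed.

Lemma size_sum_scale_Xn (A : nzRingType) n (a : 'I_n -> A) :
  (size (\sum_i a i *: 'X^i)%R <= n)%N.
Proof.
apply: (leq_trans (size_sum _ _ _)); apply/bigmax_leqP => i _.
by rewrite (leq_trans (size_scale_leq _ _)) // size_polyXn.
Qed.

Lemma coef_sum_scale_Xn (A : nzRingType) n (a : 'I_n -> A) (i : 'I_n) :
  (\sum_i a i *: 'X^i)`_i = a i.
Proof.
rewrite coef_sum (bigD1 i) //= big1 => [|j ji].
  by rewrite addr0 coefZ coefXn eqxx mulr1.
by rewrite coefZ coefXn eq_sym (inj_eq val_inj) (negPf ji) mulr0.
Qed.

Lemma scale_polyC_Xn_sum (A : comNzRingType) (V : lmodType {poly A}) n
    (a : 'I_n -> A) (e : V) :
  \sum_i (a i)%:P *: ('X^i *: e) = (\sum_i a i *: 'X^i) *: e.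
Proof.
by rewrite scaler_suml; apply: eq_bigr => i _; rewrite scalerA mul_polyC.
Qed.

(** * R-combinations and minimality of indexed families *)

Section Combinations.
Context {p alpha beta : nat}.
Local Notation V := (Rab p alpha beta).
Implicit Types (w s t : V).

Lemma generated_by_pair s t (C : {set V}) : generated_by [set s; t] C ->
  forall w, w \in C <-> exists a b, w = a *: s + b *: t.
Proof.
move=> gen w; rewrite gen; have [<-|st] := eqVneq s t.
  rewrite setUid; split=> [[a]|[a [b ->]]].
    by rewrite big_set1 => ->; exists (a s), 0; rewrite scale0r addr0.
  by exists (fun=> a + b); rewrite big_set1 scalerDl.
split=> [[a]|[a [b ->]]].
  by rewrite big_setU1 ?inE //= big_set1 => ->; exists (a s), (a t).
exists (fun x => if x == s then a else b).
by rewrite big_setU1 ?inE //= big_set1 eqxx eq_sym (negPf st).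
Qed.

(* Independence modulo the maximal ideal (u, v) of R suffices, since a redundant
   element would have coefficient -1 in a relation. *)
Definition residually_free (I : finType) (z : I -> V) :=
  forall a : I -> Zpuv p,
    \sum_i (a i)%:P *: z i = 0 -> forall i, rho (a i) = 0.

Context (I : finType) (z : I -> V) (z_free : residually_free z).

Lemma residually_free_inj : injective z.
Proof.
move=> i j eij; apply/eqP/negPn/negP => ij.
pose a k : Zpuv p := if k == i then 1 else if k == j then -1 else 0.
suff /z_free/(_ i) : \sum_k (a k)%:P *: z k = 0.
  by rewrite /a eqxx rmorph1 => /eqP; rewrite oner_eq0.
rewrite (bigD1 i) //= (bigD1 j) 1?eq_sym //= big1 => [|k /andP[ki kj]].
  rewrite addr0 /a eqxx eq_sym (negPf ij) eqxx rmorphN scale1r scaleN1r.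
  by rewrite eij subrr.
by rewrite /a (negPf ki) (negPf kj) scale0r.
Qed.

Lemma R_combination_imset w : R_combination [set z i | i : I] w <->
  exists a : I -> Zpuv p, w = \sum_i (a i)%:P *: z i.
Proof.
have zinj := residually_free_inj.
split=> [[a ->]|[a ->]].
  by exists (a \o z); rewrite big_imset //= => i j _ _; apply: zinj.
(* By injectivity at most one index lies over [t]; the sum serves as a total inverse of [z], with
   value 0 off its image. *)
exists (fun t => \sum_(i | z i == t) a i).
rewrite big_imset /=; last by move=> i j _ _; apply: zinj.
by apply: eq_bigr => i _; rewrite (big_pred1 i) // => j; rewrite /= inj_eq.
Qed.

Lemma residually_free_minimal s : s \in [set z i | i : I] ->
  ~ R_combination ([set z i | i : I] :\ s) s.
Proof.
have zinj := residually_free_inj.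
case/imsetP => j _ -> [a zj].
pose b i := if i == j then -1 else a (z i).
suff /z_free/(_ j) : \sum_i (b i)%:P *: z i = 0.
  by rewrite /b eqxx rmorphN rmorph1 => /eqP; rewrite oppr_eq0 oner_eq0.
rewrite (bigD1 j) //= {1}/b eqxx rmorphN scaleN1r {1}zj addrC.
apply/eqP; rewrite subr_eq0; apply/eqP.
have -> : [set z i | i : I] :\ z j = [set z i | i in [set~ j]].
  apply/setP=> t; rewrite !inE; apply/andP/imsetP.
    case=> tj /imsetP[i _ ti]; exists i => //; rewrite !inE.
    by apply: contraNneq tj => <-; apply/eqP.
  by case=> i; rewrite !inE => ij ->; rewrite inj_eq // ij imset_f.
rewrite big_imset /=; last by move=> i k _ _; apply: zinj.
apply: eq_big => [i|i ij]; first by rewrite !inE.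
by rewrite /b (negPf ij).
Qed.
End Combinations.

(** * Normal forms of codewords *)

Section Code.
Context {p alpha beta : nat}.
Local Notation V := (Rab p alpha beta).
Implicit Types (c f : {poly 'F_p}) (a b d G : {poly Zpuv p}).

Lemma Rab_mkD c d c' d' :
  Rab_mk c d + Rab_mk c' d' = Rab_mk (c + c') (d + d') :> V.
Proof. by rewrite /Rab_mk !rmorphD. Qed.

Lemma Rab_mkZ a c d : a *: Rab_mk c d = Rab_mk (rhoX a * c) (a * d) :> V.
Proof. by rewrite /Rab_mk !rmorphM. Qed.

Lemma Rab_mkZD a b f1 f2 G :
  a *: Rab_mk f1 0 + b *: Rab_mk f2 G
  = Rab_mk (rhoX a * f1 + rhoX b * f2) (b * G) :> V.
Proof. by rewrite !Rab_mkZ Rab_mkD mulr0 add0r. Qed.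

Context (alpha_gt0 : (0 < alpha)%N) (beta_gt0 : (0 < beta)%N)
  (f1 f2 : {poly 'F_p}) (G : {poly Zpuv p})
  (f1_dvd : f1 %| 'X^alpha - 1)
  (G_dvd : exists h : {poly Zpuv p}, 'X^beta - 1 = h * G).
Let n1 := (alpha - (size f1).-1)%N.
(** The residue of [G] sets the bound, since the u- and v-parts of [G] may have larger degree. *)
Let n2 := (beta - (size (rhoX G)).-1)%N.

(** Only [rhoX a] can be shown to vanish, because R[x] acts on the first coordinate through
    [rhoX]. *)
Lemma Rab_mk_small_eq0 a b : (size a <= n1)%N -> (size b <= n2)%N ->
  a *: Rab_mk f1 0 + b *: Rab_mk f2 G = 0 :> V -> rhoX a = 0 /\ b = 0.
Proof.
move=> sa sb; rewrite Rab_mkZD => -[].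
have [k ek] := dvdpP _ _ f1_dvd; have [h eh] := G_dvd.
have [k0 f10 sk] := size_cofactor_XnsubC1 alpha_gt0 ek.
have e : 'X^beta - 1 = rhoX h * rhoX G.
  by rewrite -rhoX_XnsubC1 eh [LHS]rmorphM.
have [h0 G0 sh] := size_cofactor_XnsubC1 beta_gt0 e.
(* The second coordinate comes first: it involves [b] alone and reads b G = q h G, where [G] can be
   cancelled. *)
move=> /[swap] /eqP/(in_qpoly_XnsubC1_eq0P _ beta_gt0)[q].
rewrite eh mulrA => /eqP; rewrite -subr_eq0 -mulrBl => /eqP.
move=> /(polyZpuv_mul_eq0 G0)/eqP; rewrite subr_eq0 => /eqP bq.
(* [rhoX h] has size [n2.+1], just above the bound on [b]. *)
have q0 : q = 0 by apply: (@polyZpuv_mul_small_eq0 _ q h); rewrite -bq sh.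
have b0 : b = 0 by rewrite bq q0 mul0r.
rewrite b0 rmorph0 mul0r addr0 => /eqP/(in_qpoly_XnsubC1_eq0P _ alpha_gt0).
case=> [q']; rewrite ek mulrA => /(mulIf f10) aq; split=> //.
have q'0 : q' = 0.
  apply: (@size_mul_small_eq0 _ q' k).
  by rewrite -aq sk ltnS (leq_trans (size_rhoX_leq a)).
by rewrite aq q'0 mul0r.
Qed.

Context (C : {set V})
  (C_gen : generated_by [set Rab_mk f1 0; Rab_mk f2 G] C)
  (ker_gen : generated_by [set Rab_mk f1 0] (ker_Pi C)).

(** The coefficient of the first generator is lifted from F_p[x], as its u- and v-parts would act as
    zero; this makes the form unique. *)
Lemma Rab_mk_span w : w \in C -> exists c b,
  [/\ (size c <= n1)%N, (size b <= n2)%N &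
      w = map_poly (@Zpuv_incl p) c *: Rab_mk f1 0 + b *: Rab_mk f2 G].
Proof.
have CP := generated_by_pair C_gen.
move=> /CP[a [b ->]]; have [k ek] := dvdpP _ _ f1_dvd; have [h eh] := G_dvd.
have [k0 f10 sk] := size_cofactor_XnsubC1 alpha_gt0 ek.
have e : 'X^beta - 1 = rhoX h * rhoX G.
  by rewrite -rhoX_XnsubC1 eh [LHS]rmorphM.
have [h0 G0 sh] := size_cofactor_XnsubC1 beta_gt0 e.
have [q [r [-> sr]]] := polyZpuv_edivp b h0.
(* Its second coordinate is h G = X^beta - 1, which is zero in the quotient. The multiple [q * h] of
   the second generator is thus absorbed by the first. *)
have hG : h *: Rab_mk f2 G \in ker_Pi C.
  rewrite inE; apply/andP; split.
    by apply/CP; exists 0, h; rewrite scale0r add0r.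
  rewrite Rab_mkZ; apply/(in_qpoly_XnsubC1_eq0P _ beta_gt0).
  by exists 1; rewrite mul1r eh.
have [a0] := (ker_gen _).1 hG; rewrite big_set1; move: (a0 _) => a' ha'.
(* Reduction modulo [k] is harmless since k f1 = X^alpha - 1 is zero in the first coordinate. *)
exists (rhoX (a + q * a') %% k), r; split.
- by rewrite -ltnS -sk ltn_modp.
- by rewrite -ltnS -sh.
rewrite [(q * h + r) *: _]scalerDl -[(q * h) *: _]scalerA ha' scalerA.
rewrite addrA -scalerDl.
congr (_ + _); rewrite !Rab_mkZ !mulr0 rhoX_incl; congr (_, _).
apply/eqP; rewrite -subr_eq0 -rmorphB; apply/(in_qpoly_XnsubC1_eq0P _ alpha_gt0).
exists (rhoX (a + q * a') %/ k); rewrite ek mulrA -mulrBl.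
by rewrite {1}[rhoX _](divp_eq _ k) addrK.
Qed.

(** Normal forms are counted by [n1] coefficients in F_p and [n2] in R. They are distinct because a
    difference of two again meets the degree bounds. *)
Lemma card_Rab_mk_span : prime p -> #|C| = (p ^ (n1 + 3 * n2))%N.
Proof.
move=> pp.
pose phi (x : {poly_n1 'F_p} * {poly_n2 (Zpuv p)}) : V :=
  map_poly (@Zpuv_incl p) x.1 *: Rab_mk f1 0
  + (x.2 : {poly Zpuv p}) *: Rab_mk f2 G.
have phi_inj : injective phi.
  move=> [c b] [c' b'] /eqP; rewrite -subr_eq0 /phi /= opprD addrACA -!scalerBl.
  move=> /eqP/Rab_mk_small_eq0[||].
  - by rewrite -rmorphB (leq_trans (size_poly _ _)) // (size_npoly (c - c')).
  - exact: (size_npoly (b - b')).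
  rewrite -rmorphB rhoX_incl => /eqP; rewrite subr_eq0 => /eqP cc.
  move=> /eqP; rewrite subr_eq0 => /eqP bb.
  by congr (_, _); apply: val_inj.
have -> : C = [set phi x | x : {poly_n1 'F_p} * {poly_n2 (Zpuv p)}].
  apply/setP=> w; apply/idP/imsetP => [/Rab_mk_span[c [b [sc sb ->]]]|[x _ ->]].
    by exists (NPoly sc, NPoly sb).
  by apply/(generated_by_pair C_gen); do 2!eexists; reflexivity.
rewrite card_imset // card_prod !card_npoly card_Fp // card_Zpuv //.
by rewrite expnD expnM.
Qed.

(** Indexing by a disjoint sum lets residual freeness also show that the shifts are pairwise
    distinct, within and across the two families. *)
Definition shifts (k : 'I_n1 + 'I_n2) : V :=
  match k with
  | inl i => 'X^i *: Rab_mk f1 0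
  | inr j => 'X^j *: Rab_mk f2 G
  end.

Lemma shifts_sum (a : 'I_n1 + 'I_n2 -> Zpuv p) :
  \sum_k (a k)%:P *: shifts k =
  (\sum_i a (inl i) *: 'X^i) *: Rab_mk f1 0
  + (\sum_j a (inr j) *: 'X^j) *: Rab_mk f2 G.
Proof. by rewrite big_sumType /= !scale_polyC_Xn_sum. Qed.

Lemma shifts_free : residually_free shifts.
Proof.
move=> a; rewrite shifts_sum => /Rab_mk_small_eq0[||e1 e2].
- exact: size_sum_scale_Xn.
- exact: size_sum_scale_Xn.
case=> i.
  have := congr1 (coefp i) e1.
  by rewrite /= coef_map coef0 /= (coef_sum_scale_Xn (fun i => a (inl i))).
have := congr1 (coefp i) e2.
by rewrite /= coef0 (coef_sum_scale_Xn (fun i => a (inr i))) => ->; apply: rmorph0.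
Qed.

Lemma shifts_minimal_generating :
  minimal_generating_set [set shifts k | k : 'I_n1 + 'I_n2] C.
Proof.
split=> [w|]; last by apply: residually_free_minimal; apply: shifts_free.
rewrite (R_combination_imset shifts_free).
split=> [/Rab_mk_span[c [b [sc sb ->]]]|[a ->]].
  exists (fun k : 'I_n1 + 'I_n2 =>
    match k with inl i => Zpuv_incl c`_i | inr j => b`_j end).
  rewrite shifts_sum; congr (_ *: _ + _ *: _).
    rewrite -(poly_def n1 (fun i => Zpuv_incl c`_i)); apply/polyP=> i.
    rewrite coef_map coef_poly; case: ltnP => // ni.
    by rewrite nth_default ?rmorph0 // (leq_trans sc).
  rewrite -(poly_def n2 (fun i => b`_i)); apply/polyP=> i.
  rewrite coef_poly; case: ltnP => // ni.
  by rewrite nth_default // (leq_trans sb).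
rewrite shifts_sum; apply/(generated_by_pair C_gen); do 2!eexists; reflexivity.
Qed.
End Code.

Theorem lemma5 (p alpha beta : nat) (p_prime : prime p)
    (alpha_gt0 : (0 < alpha)%N) (beta_gt0 : (0 < beta)%N)
    (C : {set Rab p alpha beta}) (hC : additive_cyclic_code C)
    (f1 f2 g p1 p2 : {poly 'F_p})
    (C_gen : generated_by [set Rab_mk f1 0; Rab_mk f2 (polyuv g p1 p2)] C)
    (g_dvd : exists h : {poly Zpuv p}, 'X^beta - 1 = h * polyuv g p1 p2)
    (f1_dvd : f1 %| 'X^alpha - 1)
    (ker_gen : generated_by [set Rab_mk f1 0] (ker_Pi C))
    (t1 t2 : nat) (deg_f1 : size f1 = t1.+1) (deg_g : size g = t2.+1) :
  let S1 := [set 'X^i *: Rab_mk f1 0 | i : 'I_(alpha - t1)] in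
  let S2 := [set 'X^i *: Rab_mk f2 (polyuv g p1 p2) | i : 'I_(beta - t2)] in
  minimal_generating_set (S1 :|: S2) C
  /\ #|C| = (p ^ (alpha - t1 + 3 * (beta - t2)))%N.
Proof.
move=> S1 S2.
have rG : rhoX (polyuv g p1 p2) = g := rhoX_polyuv g p1 p2.
have e1 : t1 = (size f1).-1 by rewrite deg_f1.
have e2 : t2 = (size (rhoX (polyuv g p1 p2))).-1 by rewrite rG deg_g.
rewrite /S1 /S2 e1 e2; split.
  have := shifts_minimal_generating alpha_gt0 beta_gt0 f1_dvd g_dvd C_gen ker_gen.
  congr (minimal_generating_set _ C); apply/setP=> w; rewrite inE.
  apply/imsetP/orP => [[[i|i] _ ->]|[]/imsetP[i _ ->]].
  - by left; apply: imset_f.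
  - by right; apply: imset_f.
  - by exists (inl i).
  - by exists (inr i).
exact: (card_Rab_mk_span alpha_gt0 beta_gt0 f1_dvd g_dvd C_gen ker_gen p_prime).
Qed.
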